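(* Let $(R,\mathfrak m)$ be a Cohen-Macaulay local ring of dimension $d\geq2$ with infinite residue field, let $I_1,\ldots,I_s$ be $\mathfrak m$-primary ideals of $R$ and let $\mathcal F=\{\mathcal F(\underline n)\}_{\underline n\in\mathbb Z^s}$ be an $\underline I$-admissible filtration of ideals in $R$. Then for all $\underline n\in\mathbb N^s$, $$H^1_{\mathcal R_{++}}(\mathcal R(\mathcal F))_{\underline n}\cong\frac{\breve{\mathcal F}(\underline n)}{\mathcal F(\underline n)}.$$
   Context: Notation: $\mathbb N=\{0,1,2,\ldots\}$, $s\ge1$, $e=(1,\ldots,1)\in\mathbb Z^s$; $\underline n\ge\underline m$ means componentwise inequality; $\underline n^+=(\max(n_1,0),\ldots,\max(n_s,0))$; $\underline I=(I_1,\ldots,I_s)$ and $\underline I^{\underline n}=I_1^{n_1}\cdots I_s^{n_s}$, where a nonpositive power of an ideal is $R$. Filtrations: a $\mathbb Z^s$-graded $\underline I$-filtration is a family of ideals $\mathcal F=\{\mathcal F(\underline n)\}_{\underline n\in\mathbb Z^s}$ of $R$ with $\underline I^{\underline n}\subseteq\mathcal F(\underline n)$, $\mathcal F(\underline n)\mathcal F(\underline m)\subseteq\mathcal F(\underline n+\underline m)$, and $\mathcal F(\underline m)\subseteq\mathcal F(\underline n)$ whenever $\underline m\geq\underline n$. It is $\underline I$-admissible if moreover $\mathcal F(\underline n)=\mathcal F(\underline n^+)$ for all $\underline n$ and $\bigoplus_{\underline n\in\mathbb Z^s}\mathcal F(\underline n)\underline t^{\underline n}$ is a finite module over $\bigoplus_{\underline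 n\in\mathbb Z^s}\underline I^{\underline n}\underline t^{\underline n}$, where $t_1,\dots,t_s$ are indeterminates and $\underline t^{\underline n}=t_1^{n_1}\cdots t_s^{n_s}$. Rees rings: $\mathcal R(\mathcal F)=\bigoplus_{\underline n\in\mathbb N^s}\mathcal F(\underline n)\underline t^{\underline n}$, $\mathcal R(\underline I)=\bigoplus_{\underline n\in\mathbb N^s}\underline I^{\underline n}\underline t^{\underline n}$, and $\mathcal R_{++}=\bigoplus_{\underline n\ge e}\underline I^{\underline n}\underline t^{\underline n}$, an ideal of $\mathcal R(\underline I)$. $H^1_{\mathcal R_{++}}(\mathcal R(\mathcal F))$ is the first local cohomology of the $\mathcal R(\underline I)$-module $\mathcal R(\mathcal F)$ with support in $\mathcal R_{++}$; the subscript $\underline n$ denotes the degree $\underline n$ component. The Ratliff-Rush closure filtration of $\mathcal F$ is $\breve{\mathcal F}=\{\breve{\mathcal F}(\underline n)\}_{\underline n\in\mathbb Z^s}$ with $\breve{\mathcal F}(\underline n)=\bigcup_{k\ge1}(\mathcal F(\underline n+ke):\mathcal F(e)^k)$ for $\underline n\in\mathbb N^s$ and $\breve{\mathcal F}(\underline n)=\breve{\mathcal F}(\underline n^+)$ for all $\underline n\in\mathbb Z^s$. *)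

(* Defs.v *)
From HB Require Import structures.
From mathcomp Require Import all_boot all_order all_algebra finmap.
From mathcomp Require Import boolp classical_sets functions cardinality.
From mathcomp Require Import monalg zify.

Set Implicit Arguments.
Unset Strict Implicit.
Unset Printing Implicit Defensive.

Import Order.TTheory GRing.Theory Num.Theory.
Local Open Scope ring_scope.

Section SubmoduleOfSet.
Context (R : pzRingType) (V : lmodType R) (P : set V).
Hypothesis P_submod : P 0 /\ forall a u v, P u -> P v -> P (a *: u + v).

Fact submod_of_set_subproof : submod_closed (fun x => `[< P x >]).
Proof.
split=> [|a u v]; first by apply/asboolP; case: P_submod.
by move=> /asboolP Pu /asboolP Pv; apply/asboolP; apply: P_submod.2.
Qed.

Definition submod_of_set : submodClosed V :=
  HB.pack_for (submodClosed V) (fun x => `[< P x >])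
    (GRing.isSubmodClosed.Build R V (fun x => `[< P x >])
       submod_of_set_subproof).

Lemma submod_of_setE x : (x \in submod_of_set) = `[< P x >].
Proof. by []. Qed.

Lemma submod_of_setP x : reflect (P x) (x \in submod_of_set).
Proof. exact: asboolP. Qed.
End SubmoduleOfSet.

Section Span.
Context (R : pzRingType) (V : lmodType R).

Fact gen_submod_subproof (X : set V) :
  let P v := forall N : submodClosed V, (forall x, X x -> x \in N) -> v \in N in
  P 0 /\ forall a u v, P u -> P v -> P (a *: u + v).
Proof.
split=> [N _|a u v Pu Pv N XN]; first exact: rpred0.
by rewrite rpredD ?rpredZ ?Pu ?Pv.
Qed.

Definition gen_submod (X : set V) : submodClosed V :=
  submod_of_set (gen_submod_subproof X).

Lemma gen_submodP (X : set V) v :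
  reflect (forall N : submodClosed V, (forall x, X x -> x \in N) -> v \in N)
          (v \in gen_submod X).
Proof. exact: submod_of_setP. Qed.

Lemma mem_gen_submod (X : set V) x : X x -> x \in gen_submod X.
Proof. by move=> Xx; apply/gen_submodP => N; apply. Qed.

Lemma gen_submod_sub (X : set V) (N : submodClosed V) :
  (forall x, X x -> x \in N) -> {subset gen_submod X <= N}.
Proof. by move=> XN v /gen_submodP; apply. Qed.

Definition finitely_generated (N : submodClosed V) : Prop :=
  exists X : seq V, N =i gen_submod [set` X].
End Span.

Section Full.
Context (R : pzRingType) (V : lmodType R).

Definition full_submod : submodClosed V :=
  @submod_of_set R V setT (conj I (fun _ _ _ _ _ => I)).

Lemma mem_full_submod x : x \in full_submod.
Proof. exact/submod_of_setP. Qed.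
End Full.

Definition finite_module (R : pzRingType) (V : lmodType R) : Prop :=
  finitely_generated (full_submod V).

Section SubmoduleType.
Context (R : pzRingType) (V : lmodType R) (N : submodClosed V).

Record submodule : predArgType :=
  Submodule { submodule_val : V; _ : submodule_val \in N }.

HB.instance Definition _ := [isSub for submodule_val].
HB.instance Definition _ := [Choice of submodule by <:].
HB.instance Definition _ := [SubChoice_isSubLmodule of submodule by <:].

Fact submodule_val_is_linear : linear submodule_val.
Proof. by []. Qed.

HB.instance Definition _ :=
  GRing.isLinear.Build R submodule V _ submodule_val submodule_val_is_linear.
End SubmoduleType.

Section QuotientModule.
Context (R : pzRingType) (V : lmodType R) (N : submodClosed V).
Local Open Scope quotient_scope.

Fact submod_zmod_closed : zmod_closed (fun x => x \in N).
Proof.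
split=> [|x y Nx Ny]; first exact: rpred0.
by rewrite -scaleN1r rpredD ?rpredZ.
Qed.

Definition submod_zmod : zmodClosed V :=
  HB.pack_for (zmodClosed V) (fun x => x \in N)
  (GRing.isZmodClosed.Build V (fun x => x \in N) submod_zmod_closed).

Definition quotmod : Type := Quotient.quot submod_zmod.
HB.instance Definition _ := GRing.Zmodule.on quotmod.

Definition quot_proj (x : V) : quotmod := \pi_(Quotient.quot submod_zmod) x.

Lemma quot_proj_surj (q : quotmod) : exists x, q = quot_proj x.
Proof. by exists (repr q); rewrite /quot_proj reprK. Qed.

Lemma quot_projE x y : (quot_proj x = quot_proj y) <-> (x - y \in N).
Proof.
rewrite -[x - y \in N]/(x - y \in submod_zmod) Quotient.idealrBE.
by split => /eqP.
Qed.

Fact quot_proj_is_zmod_morphism : zmod_morphism quot_proj.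
Proof. by move=> x y; rewrite /quot_proj raddfB. Qed.

HB.instance Definition _ :=
  GRing.isZmodMorphism.Build V quotmod quot_proj quot_proj_is_zmod_morphism.

Definition quot_scale (a : R) (q : quotmod) : quotmod :=
  quot_proj (a *: (repr (q : Quotient.quot submod_zmod))).

Lemma quot_scaleE a x : quot_scale a (quot_proj x) = quot_proj (a *: x).
Proof.
apply/quot_projE; rewrite -scalerBr rpredZ //.
by apply/quot_projE; rewrite {1}/quot_proj reprK.
Qed.

Fact quot_scaleA a b q : quot_scale a (quot_scale b q) = quot_scale (a * b) q.
Proof. by have [x ->] := quot_proj_surj q; rewrite !quot_scaleE scalerA. Qed.

Fact quot_scale1 : left_id 1 quot_scale.
Proof.
by move=> q; have [x ->] := quot_proj_surj q; rewrite quot_scaleE scale1r.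
Qed.

Fact quot_scaleDr : right_distributive quot_scale +%R.
Proof.
move=> a p q; have [[x ->] [y ->]] := (quot_proj_surj p, quot_proj_surj q).
by rewrite -raddfD !quot_scaleE scalerDr raddfD.
Qed.

Fact quot_scaleDl q : {morph quot_scale^~ q : a b / a + b}.
Proof.
move=> a b /=; have [x ->] := quot_proj_surj q.
by rewrite !quot_scaleE scalerDl raddfD.
Qed.

HB.instance Definition _ := GRing.Zmodule_isLmodule.Build R quotmod
  quot_scaleA quot_scale1 quot_scaleDr quot_scaleDl.
End QuotientModule.

(* B need not be contained in A: subquotient A B is A / (A :&: B). *)
Section Subquotient.
Context (R : pzRingType) (V : lmodType R) (A B : submodClosed V).

Fact trace_subproof :
  let P (x : submodule A) := submodule_val x \in B in
  P 0 /\ forall a u v, P u -> P v -> P (a *: u + v).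
Proof.
split=> [|a u v Bu Bv]; first by rewrite raddf0 rpred0.
by rewrite linearP rpredD ?rpredZ.
Qed.

Definition trace_submod : submodClosed (submodule A) :=
  submod_of_set trace_subproof.

Definition subquotient : lmodType R := quotmod trace_submod.
End Subquotient.

Definition isomorphic (R : pzRingType) (V W : lmodType R) : Prop :=
  exists f : {linear V -> W}, bijective f.

Definition restr_scalars (A B : pzRingType) (f : {rmorphism A -> B})
  (V : lmodType B) : Type := V.

Section Restriction.
Context (A B : pzRingType) (f : {rmorphism A -> B}) (V : lmodType B).
Local Notation restr_scalars := (restr_scalars f V).

HB.instance Definition _ := GRing.Zmodule.on restr_scalars.

Definition restr_scale (a : A) (x : restr_scalars) : restr_scalars :=
  f a *: (x : V).

Fact restr_scaleA a b x : restr_scale a (restr_scale b x) = restr_scale (a * b) x.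
Proof. by rewrite /restr_scale scalerA rmorphM. Qed.
Fact restr_scale1 : left_id 1 restr_scale.
Proof. by move=> x; rewrite /restr_scale rmorph1 scale1r. Qed.
Fact restr_scaleDr : right_distributive restr_scale +%R.
Proof. by move=> a x y; rewrite /restr_scale scalerDr. Qed.
Fact restr_scaleDl x : {morph restr_scale^~ x : a b / a + b}.
Proof. by move=> a b; rewrite /restr_scale rmorphD scalerDl. Qed.

HB.instance Definition _ := GRing.Zmodule_isLmodule.Build A restr_scalars
  restr_scaleA restr_scale1 restr_scaleDr restr_scaleDl.
End Restriction.

Notation ideal R := (submodClosed R^o).

Section Ideals.
Context {R : comNzRingType}.
Implicit Types (I J K A B C X Y Z P m : ideal R).

Lemma ideal0 I : (0 : R) \in I. Proof. exact: (@rpred0 R^o I). Qed.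

Lemma idealD I (x y : R) : x \in I -> y \in I -> x + y \in I.
Proof. exact: (@rpredD R^o I x y). Qed.

Lemma idealMl I (a x : R) : x \in I -> a * x \in I.
Proof. exact: (@rpredZ R R^o I a x). Qed.

Definition ideal_mul I J : ideal R :=
  gen_submod [set z : R^o | exists x y : R, [/\ x \in I, y \in J & z = x * y]].

Definition ideal_pow I (k : nat) : ideal R :=
  iter k (ideal_mul I) (full_submod R^o).

Fact colon_subproof I J :
  let P (x : R^o) := forall y : R, y \in J -> (x : R) * y \in I in
  P 0 /\ forall a u v, P u -> P v -> P (a *: u + v).
Proof.
split=> [y _|a u v Pu Pv y Jy] /=; first by rewrite mul0r; apply: ideal0.
by rewrite mulrDl -mulrA; apply: idealD; [apply/idealMl/Pu | apply: Pv].
Qed.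

Definition colon I J : ideal R := submod_of_set (colon_subproof I J).

Lemma colonP I J (x : R) :
  reflect (forall y : R, y \in J -> x * y \in I) (x \in colon I J).
Proof. exact: (submod_of_setP (colon_subproof I J)). Qed.

Lemma mem_ideal_mul I J (x y : R) :
  x \in I -> y \in J -> x * y \in ideal_mul I J.
Proof. by move=> Ix Jy; apply: mem_gen_submod; exists x, y. Qed.

Fact scaled_subproof I (w : R) :
  let P (v : R^o) := w * (v : R) \in I in
  P 0 /\ forall a u v, P u -> P v -> P (a *: u + v).
Proof.
split=> [|a u v Pu Pv] /=; first by rewrite mulr0; apply: ideal0.
by rewrite mulrDr mulrCA; apply: idealD => //; apply: idealMl.
Qed.

Lemma ideal_mul_sub I J K (w : R) :
  (forall x y : R, x \in I -> y \in J -> w * (x * y) \in K) ->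
  forall v : R, v \in ideal_mul I J -> w * v \in K.
Proof.
move=> IJK v vIJ; apply/(submod_of_setP (scaled_subproof K w)).
apply: (@gen_submod_sub R R^o _ (submod_of_set (scaled_subproof K w)) _ v vIJ).
by move=> _ [x [y [Ix Jy ->]]]; apply/(submod_of_setP (scaled_subproof K w))/IJK.
Qed.

Lemma ideal_mul_compat A B C X Y Z :
  (forall x y : R, x \in A -> y \in B -> x * y \in C) ->
  (forall x y : R, x \in X -> y \in Y -> x * y \in Z) ->
  forall u v : R, u \in ideal_mul A X -> v \in ideal_mul B Y ->
  u * v \in ideal_mul C Z.
Proof.
move=> ABC XYZ u v uAX; apply: ideal_mul_sub => b y Bb Yy; rewrite mulrC.
move: u uAX; apply: ideal_mul_sub => a x Aa Xx; rewrite mulrC mulrACA.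
by apply: mem_ideal_mul; [apply: ABC | apply: XYZ].
Qed.

Lemma ideal_mulSr I J (x : R) : x \in ideal_mul I J -> x \in J.
Proof.
move=> xIJ; rewrite -(mul1r x); apply: ideal_mul_sub xIJ => a y _ Jy.
by rewrite mul1r; apply: idealMl.
Qed.

Lemma ideal_powS I k l (x : R) :
  (k <= l)%N -> x \in ideal_pow I l -> x \in ideal_pow I k.
Proof.
move/subnK <-; elim: (l - k)%N => // j IH; rewrite addSn => Ix.
exact: IH (ideal_mulSr Ix).
Qed.

Lemma ideal_powM I k l (x y : R) :
  x \in ideal_pow I k -> y \in ideal_pow I l -> x * y \in ideal_pow I (k + l).
Proof.
elim: k x y => [|k IH] x y; first by move=> _ ?; apply: idealMl.
move=> xIk yIl; rewrite mulrC; move: x xIk; apply: ideal_mul_sub => a b Ia Ib.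
by rewrite mulrC -mulrA; apply: mem_ideal_mul => //; apply: IH.
Qed.

Definition radical I : set R := [set x | exists k : nat, x ^+ k \in I].

Definition ideal_proper I : Prop := 1 \notin I.

Definition ideal_prime P : Prop :=
  ideal_proper P /\ @prime_idealr_closed R P.

Definition ideal_maximal m : Prop :=
  ideal_proper m /\
  forall J, {subset m <= J} -> ideal_proper J -> {subset J <= m}.

Definition ideal_primary I : Prop :=
  ideal_proper I /\
  forall x y : R, x * y \in I -> x \in I \/ exists k : nat, y ^+ k \in I.

Definition primary_to m I : Prop :=
  ideal_primary I /\ forall x : R, radical I x <-> x \in m.

Definition local_ring m : Prop :=
  ideal_maximal m /\ forall J, ideal_maximal J -> J =i m.

Definition residue_field m : lmodType R := quotmod m.

Definition prime_chain (c : nat -> ideal R) (k : nat) : Prop :=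
  (forall i, (i <= k)%N -> ideal_prime (c i)) /\
  (forall i, (i < k)%N ->
     {subset c i <= c i.+1} /\ ~ {subset c i.+1 <= c i}).

Definition regular_sequence I (xs : seq R) : Prop :=
  [/\ {subset xs <= I},
      forall (i : nat) (y : R), (i < size xs)%N ->
        y * xs`_i \in gen_submod [set` (take i xs : seq R^o)] ->
        y \in gen_submod [set` (take i xs : seq R^o)]
    & ideal_proper (gen_submod [set` (xs : seq R^o)])].

Definition has_depth m (k : nat) : Prop :=
  (exists xs, regular_sequence m xs /\ size xs = k) /\
  (forall xs, regular_sequence m xs -> (size xs <= k)%N).
End Ideals.

Definition noetherian (R : comNzRingType) : Prop :=
  forall I : ideal R, finitely_generated I.

Definition krull_dim (R : comNzRingType) (k : nat) : Prop :=
  (exists c, @prime_chain R c k) /\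
  (forall c j, @prime_chain R c j -> (j <= k)%N).

Definition cohen_macaulay_local (R : comNzRingType) (m : ideal R) (d : nat)
    : Prop :=
  [/\ noetherian R, local_ring m, krull_dim R d & has_depth m d].

Notation multideg s := {ffun 'I_s -> int}.

(* The monomial algebra of multinomials has no ring structure over Z^s, whose *)
(* elements are invertible, so the convolution product is introduced here;    *)
(* p@_n is the coefficient of t^n and << c *g n >> is the monomial c t^n.     *)
Section Laurent.
Context (R : comNzRingType) (s : nat).

Definition laurent : Type := {malg R[multideg s]}.
HB.instance Definition _ := GRing.Lmodule.on laurent.

Implicit Types p q : laurent.

Definition laurent_one : laurent := << 1 *g (0 : multideg s) >>.
Definition laurent_mul p q : laurent :=
  \sum_(k <- msupp p) \sum_(l <- msupp q) << p@_k * q@_l *g (k + l)%R >>.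

Lemma laurent_mulw (d1 d2 : {fset multideg s}) p q :
  (msupp p `<=` d1)%fset -> (msupp q `<=` d2)%fset ->
  laurent_mul p q =
  \sum_(k <- d1) \sum_(l <- d2) << p@_k * q@_l *g (k + l)%R >>.
Proof.
move=> le1 le2; rewrite /laurent_mul (big_fset_incl _ le1) /=.
  apply/eq_bigr => k _; apply/big_fset_incl => // l _ /mcoeff_outdom ->.
  by rewrite mulr0 monalgU0.
move=> k _ /mcoeff_outdom pk.
by rewrite big1 // => l _; rewrite pk mul0r monalgU0.
Qed.

Fact laurent_mulC : commutative laurent_mul.
Proof.
move=> p q; rewrite /laurent_mul exchange_big /=.
by do 2![apply/eq_bigr => ? _]; rewrite mulrC addrC.
Qed.

Fact laurent_mulDl : left_distributive laurent_mul +%R.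
Proof.
move=> p q r; have le := fsubset_refl (msupp r).
rewrite (laurent_mulw (msuppD_le p q) le).
rewrite (laurent_mulw (fsubsetUl (msupp p) (msupp q)) le).
rewrite (laurent_mulw (fsubsetUr (msupp p) (msupp q)) le).
rewrite -big_split /=; apply/eq_bigr=> k _.
rewrite -big_split /=; apply/eq_bigr=> l _.
by rewrite mcoeffD mulrDl monalgUD.
Qed.

Lemma laurent_mulDr : right_distributive laurent_mul +%R.
Proof. by move=> p q r; rewrite laurent_mulC laurent_mulDl !(laurent_mulC p). Qed.

Lemma laurent_mul0l : left_zero 0 laurent_mul.
Proof. by move=> p; rewrite /laurent_mul msupp0 big_seq_fset0. Qed.

Lemma laurent_mul0r : right_zero 0 laurent_mul.
Proof. by move=> p; rewrite laurent_mulC laurent_mul0l. Qed.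

Lemma laurent_mulUU a b (k l : multideg s) :
  laurent_mul << a *g k >> << b *g l >> = << a * b *g (k + l)%R >>.
Proof. by rewrite (laurent_mulw msuppU_le msuppU_le) !big_seq_fset1 !mcoeffUU. Qed.

Lemma laurent_mul_suml (J : Type) (r : seq J) (G : J -> laurent) p :
  laurent_mul (\sum_(j <- r) G j) p = \sum_(j <- r) laurent_mul (G j) p.
Proof.
exact: (big_morph (laurent_mul^~ p) (fun x y => laurent_mulDl x y p)
          (laurent_mul0l p)).
Qed.

Lemma laurent_mul_sumr (J : Type) (r : seq J) (G : J -> laurent) p :
  laurent_mul p (\sum_(j <- r) G j) = \sum_(j <- r) laurent_mul p (G j).
Proof.
rewrite laurent_mulC laurent_mul_suml.
by apply: eq_bigr => j _; rewrite laurent_mulC.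
Qed.

Fact laurent_mulA : associative laurent_mul.
Proof.
move=> p q r; rewrite [p]monalgE.
rewrite (laurent_mul_suml _ _ (laurent_mul q r)) (laurent_mul_suml _ _ q).
rewrite (laurent_mul_suml _ _ r); apply: eq_bigr => i _.
rewrite [q]monalgE (laurent_mul_suml _ _ r) !(laurent_mul_sumr _ _ << _ *g i >>).
rewrite (laurent_mul_suml _ _ r); apply: eq_bigr => j _.
rewrite [r]monalgE (laurent_mul_sumr _ _ << _ *g j >>).
rewrite !(laurent_mul_sumr (msupp r)); apply: eq_bigr => k _.
by rewrite !laurent_mulUU mulrA addrA.
Qed.

Fact laurent_mul1l : left_id laurent_one laurent_mul.
Proof.
move=> p; rewrite {2}[p]monalgE.
rewrite (laurent_mulw msuppU_le (fsubset_refl _)) big_seq_fset1.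
by apply/eq_bigr => k _; rewrite mcoeffUU mul1r add0r.
Qed.

Fact laurent_one_neq0 : laurent_one != 0.
Proof.
apply/eqP => /(congr1 (mcoeff (0 : multideg s)))/eqP.
by rewrite mcoeffUU mcoeff0 oner_eq0.
Qed.

HB.instance Definition _ := GRing.Zmodule_isComNzRing.Build laurent
  laurent_mulA laurent_mulC laurent_mul1l laurent_mulDl laurent_one_neq0.

Fact laurent_scaleAl (c : R) p q : c *: (p * q) = (c *: p) * q.
Proof.
have le : (msupp (c *: p) `<=` msupp p)%fset := msuppZ_le c p.
rewrite [RHS](laurent_mulw le (fsubset_refl _)) scaler_sumr.
apply/eq_bigr => k _; rewrite scaler_sumr; apply/eq_bigr=> l _.
by apply/malgP => j; rewrite !mcoeffsE mulrnAr mulrA.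
Qed.

HB.instance Definition _ := GRing.Lmodule_isLalgebra.Build R laurent
  laurent_scaleAl.
HB.instance Definition _ := GRing.Lalgebra_isComAlgebra.Build R laurent.

Lemma mcoeff_laurentM p q n : (p * q)@_n =
  \sum_(k <- msupp p) \sum_(l <- msupp q) p@_k * q@_l *+ (k + l == n)%R.
Proof.
rewrite raddf_sum; apply/eq_bigr => k _; rewrite raddf_sum /=.
by apply/eq_bigr => l _; rewrite mcoeffU.
Qed.
End Laurent.

(* M is the direct sum of the gr n: c@_n is the component of x in degree n *)
Definition direct_sum (G : choiceType) (M : zmodType) (gr : G -> set M)
    : Prop :=
  forall x, exists! c : {malg M[G]},
    (forall n, gr n c@_n) /\ x = \sum_(n <- msupp c) c@_n.

Record gradedAlg (R : comNzRingType) (G : zmodType) := GradedAlg {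
  galg :> comAlgType R;
  galg_piece : G -> submodClosed galg;
  galg_one : 1 \in galg_piece 0;
  galg_mul : forall m n (x y : galg),
    x \in galg_piece m -> y \in galg_piece n -> x * y \in galg_piece (m + n);
  galg_direct : direct_sum (fun n x => x \in galg_piece n)
}.

Definition base_module (R : comNzRingType) (A : comAlgType R) (V : lmodType A)
  : lmodType R := restr_scalars (GRing.in_alg A) V.

Record gradedMod (R : comNzRingType) (G : zmodType) (A : gradedAlg R G) :=
  GradedMod {
  gmod :> lmodType A;
  gmod_piece : G -> submodClosed (base_module gmod);
  gmod_scale : forall m n (a : A) (x : gmod),
    a \in galg_piece A m -> x \in gmod_piece n -> a *: x \in gmod_piece (m + n);
  gmod_direct : direct_sum (fun n (x : gmod) => x \in gmod_piece n)
}.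

Section GradedModules.
Context (R : comNzRingType) (G : zmodType) (A : gradedAlg R G).
Implicit Types M N E : gradedMod A.

Definition degree0 M N (f : M -> N) : Prop :=
  forall n (x : M), x \in gmod_piece M n -> f x \in gmod_piece N n.

(* injective object of the category of graded A-modules and degree 0 maps *)
Definition graded_injective E : Prop :=
  forall M N (i : {linear M -> N}) (f : {linear M -> E}),
    degree0 i -> degree0 f -> injective i ->
    exists g : {linear N -> E}, degree0 g /\ forall x, g (i x) = f x.

Record injective_resolution M := InjectiveResolution {
  res_obj :> nat -> gradedMod A;
  res_aug : {linear M -> res_obj 0};
  res_diff : forall i, {linear res_obj i -> res_obj i.+1};
  res_aug_degree0 : degree0 res_aug;
  res_diff_degree0 : forall i, degree0 (res_diff i);
  res_aug_inj : injective res_aug;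
  res_exact0 : forall x, res_diff 0 x = 0 <-> exists y, x = res_aug y;
  res_exactS : forall i x, res_diff i.+1 x = 0 <-> exists y, x = res_diff i y;
  res_injective : forall i, graded_injective (res_obj i)
}.
End GradedModules.

Section Torsion.
Context (A : comNzRingType) (J : ideal A) (V : lmodType A).

Fact torsion_subproof :
  let P (x : V) := exists k : nat, forall a : A, a \in ideal_pow J k -> a *: x = 0
  in P 0 /\ forall a u v, P u -> P v -> P (a *: u + v).
Proof.
split=> [|a u v [k ku] [l lv]]; first by exists 0%N => a _; rewrite scaler0.
exists (maxn k l) => b Jb; rewrite scalerDr scalerA mulrC -scalerA.
rewrite ku ?lv ?scaler0 ?addr0 //.
  by apply: ideal_powS Jb; rewrite leq_maxr.
by apply: ideal_powS Jb; rewrite leq_maxl.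
Qed.

Definition torsion : submodClosed V := submod_of_set torsion_subproof.
End Torsion.

Section LocalCohomology.
Context (R : comNzRingType) (G : zmodType) (A : gradedAlg R G).
Context (J : ideal A) (M : gradedMod A) (E : injective_resolution M).

Fact cocycles_subproof (i : nat) (n : G) :
  let P (x : base_module (E i)) :=
    [/\ x \in gmod_piece (E i) n, (x : E i) \in torsion J (E i)
      & res_diff E i x = 0] in
  P 0 /\ forall a u v, P u -> P v -> P (a *: u + v).
Proof.
split=> [|a u v [nu tu du] [nv tv dv]].
  by split; [exact: rpred0 | exact: (rpred0 (torsion J (E i))) | exact: raddf0].
split; first by rewrite rpredD ?rpredZ.
  by apply: (@rpredD _ (torsion J (E i))) => //; apply: rpredZ.
by rewrite (linearP (res_diff E i) (GRing.in_alg A a)) du dv scaler0 addr0.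
Qed.

Definition boundary (i : nat) : set (E i) :=
  match i return set (E i) with
  | 0 => [set x | x = 0]
  | j.+1 => [set x | exists2 y : E j, y \in torsion J (E j) & x = res_diff E j y]
  end.

Fact coboundaries_subproof (i : nat) :
  let P (x : base_module (E i)) := boundary x in
  P 0 /\ forall a u v, P u -> P v -> P (a *: u + v).
Proof.
case: i => [|i] /=.
  by split=> // a u v -> ->; rewrite scaler0 addr0.
split; first by exists 0; [exact: (rpred0 (torsion J (E i))) | exact/esym/raddf0].
move=> a _ _ [x tx ->] [y ty ->]; exists (GRing.in_alg A a *: x + y).
  by apply: (@rpredD _ (torsion J (E i))) => //; apply: rpredZ.
by rewrite (linearP (res_diff E i)).
Qed.

Definition cocycles (i : nat) (n : G) : submodClosed (base_module (E i)) :=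
  submod_of_set (cocycles_subproof i n).

Definition coboundaries (i : nat) : submodClosed (base_module (E i)) :=
  submod_of_set (coboundaries_subproof i).

(* H^i_J(M)_n, where H^i_J is the i-th right derived functor of Gamma_J on    *)
(* graded modules, computed with the resolution E of M. The coboundaries form *)
(* a graded submodule of the cocycles, so that the degree n component of the  *)
(* cohomology is the quotient of the cocycles of degree n, taken as an        *)
(* R-module.                                                                  *)
Definition local_cohomology (i : nat) (n : G) : lmodType R :=
  subquotient (cocycles i n) (coboundaries i).
End LocalCohomology.

Section Multidegrees.
Context {s : nat}.
Implicit Types n m : multideg s.

Definition mle n m : Prop := forall i, n i <= m i.
Definition mpos n : multideg s := [ffun i => Num.max (n i) 0].
Definition mone : multideg s := [ffun => 1].

Definition nneg_pred : {pred multideg s} := fun n => [forall i, 0 <= n i].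

Fact nneg_closed : addr_closed nneg_pred.
Proof.
split=> [|n m /forallP n0 /forallP m0]; apply/forallP => i; rewrite !ffunE //.
by rewrite addr_ge0.
Qed.

Definition nneg : addrClosed (multideg s) :=
  HB.pack_for (addrClosed (multideg s))
  nneg_pred (GRing.isAddClosed.Build (multideg s) nneg_pred nneg_closed).

Fact allZ_closed : addr_closed (predT : {pred multideg s}).
Proof. by []. Qed.

Definition allZ : addrClosed (multideg s) :=
  HB.pack_for (addrClosed (multideg s))
  (predT : {pred multideg s})
  (GRing.isAddClosed.Build (multideg s) (predT : {pred multideg s}) allZ_closed).
End Multidegrees.

Section MultiPower.
Context (R : comNzRingType) (s : nat) (I : 'I_s -> ideal R).

(* I^n = I_1^(n_1) ... I_s^(n_s), where nonpositive powers are R *)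
Definition multipow (n : multideg s) : ideal R :=
  \big[ideal_mul/full_submod R^o]_(i < s) ideal_pow (I i) `|mpos n i|%N.

Lemma multipow0 (x : R) : x \in multipow 0.
Proof.
rewrite /multipow; elim/big_rec: _ => [|i J _ J1]; first exact: mem_full_submod.
rewrite !ffunE maxxx -(mul1r x); apply: mem_ideal_mul => //.
exact: (mem_full_submod (1 : R^o)).
Qed.

Lemma multipowM m n (x y : R) :
  x \in multipow m -> y \in multipow n -> x * y \in multipow (m + n).
Proof.
move: x y; pose K3 (J K L : ideal R) :=
  forall x y : R, x \in J -> y \in K -> x * y \in L.
rewrite -[forall x y, _]/(K3 _ _ _) /multipow.
apply: (big_rec3 K3) => [x y _ _|i J K L _ IH]; first exact: mem_full_submod.
apply: ideal_mul_compat => // x y xI yI.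
apply: ideal_powS (ideal_powM xI yI); rewrite !ffunE.
by case: (lerP (m i) 0); case: (lerP (n i) 0); case: (lerP (m i + n i) 0); lia.
Qed.
End MultiPower.

Section ReesRing.
Context (R : comNzRingType) (s : nat) (D : addrClosed (multideg s)).
Context (I : 'I_s -> ideal R).

Definition rees_pred : {pred laurent R s} := fun p =>
  `[< forall n, p@_n \in multipow I n /\ (n \notin D -> p@_n = 0) >].

Fact rees_closed : subalg_closed rees_pred.
Proof.
split=> [|a p q /asboolP Ip /asboolP Iq|p q /asboolP Ip /asboolP Iq];
    apply/asboolP => n.
- rewrite mcoeffU; case: (eqVneq 0 n) => [<-|_]; split.
  + exact: multipow0.
  + by rewrite rpred0.
  + exact: ideal0.
  + by [].
- have [[pn pD] [qn qD]] := (Ip n, Iq n).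
  rewrite mcoeffD mcoeffZ; split; first by apply: idealD => //; apply: idealMl.
  by move=> nD; rewrite pD // qD // mulr0 addr0.
- rewrite mcoeff_laurentM; split.
    apply: (@rpred_sum _ (multipow I n)) => k _.
    apply: (@rpred_sum _ (multipow I n)) => l _.
    case: eqP => [<-|_]; last exact: ideal0.
    by apply: multipowM; [exact: (Ip k).1 | exact: (Iq l).1].
  move=> nD; rewrite big1 // => k _; rewrite big1 // => l _.
  case: eqP => // kl; rewrite mulr1n; apply: contraNeq nD => nz.
  rewrite -kl rpredD //.
    by apply: contra_neqT nz => /(Ip k).2 ->; rewrite mul0r.
  by apply: contra_neqT nz => /(Iq l).2 ->; rewrite mulr0.
Qed.

HB.instance Definition _ :=
  GRing.isSubalgClosed.Build R (laurent R s) rees_pred rees_closed.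

(* The Rees ring is rees nneg I, and the extended Rees ring is rees allZ I. *)
Record rees : predArgType :=
  Rees { rees_val : laurent R s; _ : rees_val \in rees_pred }.

HB.instance Definition _ := [isSub for rees_val].
HB.instance Definition _ := [Choice of rees by <:].
HB.instance Definition _ := [SubChoice_isSubComNzRing of rees by <:].
HB.instance Definition _ := [SubZmodule_isSubLmodule of rees by <:].
HB.instance Definition _ := [SubNzRing_SubLmodule_isSubLalgebra of rees by <:].
HB.instance Definition _ := [SubLalgebra_isSubAlgebra of rees by <:].

Fact rees_val_is_linear : linear rees_val. Proof. by []. Qed.
HB.instance Definition _ :=
  GRing.isLinear.Build R rees (laurent R s) _ rees_val rees_val_is_linear.

Fact rees_val_is_monoid_morphism : monoid_morphism rees_val. Proof. by []. Qed.
HB.instance Definition _ := GRing.isMonoidMorphism.Build rees (laurent R s)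
  rees_val rees_val_is_monoid_morphism.

End ReesRing.

Record filtration (R : comNzRingType) (s : nat) (I : 'I_s -> ideal R) :=
  Filtration {
  fil :> multideg s -> ideal R;
  fil_pow : forall n, {subset multipow I n <= fil n};
  fil_mul : forall n m, {subset ideal_mul (fil n) (fil m) <= fil (n + m)};
  fil_mono : forall n m, mle n m -> {subset fil m <= fil n}
}.

Section ReesModule.
Context (R : comNzRingType) (s : nat) (D : addrClosed (multideg s)).
Context (I : 'I_s -> ideal R) (F : filtration I).

Definition laurent_module : lmodType (rees D I) :=
  restr_scalars (@rees_val R s D I) (laurent R s)^o.

Fact rees_module_subproof :
  let P (p : laurent_module) := forall n,
    (p : laurent R s)@_n \in F n /\ (n \notin D -> (p : laurent R s)@_n = 0) in
  P 0 /\ forall a u v, P u -> P v -> P (a *: u + v).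
Proof.
split=> [n|a u v Pu Pv n].
  by split; rewrite mcoeff0 //; apply: ideal0.
have [[un uD] [vn vD]] := (Pu n, Pv n).
rewrite -[a *: u]/(rees_val a * u) mcoeffD.
have /asboolP Ia : rees_val a \in rees_pred D I by apply: valP.
rewrite mcoeff_laurentM; split.
  apply: idealD => //; apply: (@rpred_sum _ (F n)) => k _.
  apply: (@rpred_sum _ (F n)) => l _.
  case: eqP => [<-|_]; last exact: ideal0.
  by apply/fil_mul/mem_ideal_mul; [apply/fil_pow/(Ia k).1 | apply: (Pu l).1].
move=> nD; rewrite vD // addr0 big1 // => k _; rewrite big1 // => l _.
case: eqP => // kl; rewrite mulr1n; apply: contraNeq nD => nz.
rewrite -kl rpredD //.
  by apply: contra_neqT nz => /(Ia k).2 ->; rewrite mul0r.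
by apply: contra_neqT nz => /(Pu l).2 ->; rewrite mulr0.
Qed.

Definition rees_submod : submodClosed laurent_module :=
  submod_of_set rees_module_subproof.

Definition rees_module : lmodType (rees D I) := submodule rees_submod.

Lemma rees_module_valZ (a : rees D I) (p : rees_module) :
  submodule_val (a *: p) = rees_val a * submodule_val p :> laurent R s.
Proof.
exact: (linearZ_LR (@submodule_val _ _ rees_submod
  : {linear submodule rees_submod -> laurent_module})).
Qed.
End ReesModule.

Section Gradings.
Context (R : comNzRingType) (s : nat).

(* M inherits the grading of the Laurent polynomials if it embeds into them   *)
(* and contains the components of its elements.                               *)
Lemma direct_sum_laurent (M : zmodType) (f : {additive M -> laurent R s})
    (gr : multideg s -> set M) :
  injective f ->
  (forall n x, gr n x <-> forall k, k != n -> (f x)@_k = 0) ->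
  (forall x n, exists y, f y = << (f x)@_n *g n >>) ->
  direct_sum gr.
Proof.
move=> f_inj grP /(_ _)/choice comp x; have [h hE] := comp x.
pose c : {malg M[multideg s]} := [malg n in msupp (f x) => h n].
have cE n : c@_n = h n.
  rewrite mcoeffE; case: ifPn => // /mcoeff_outdom xn.
  by apply: f_inj; rewrite hE xn monalgU0 raddf0.
exists c; split; first split.
- by move=> n; apply/grP => k kn; rewrite cE hE mcoeffU eq_sym (negPf kn).
- apply: f_inj; rewrite raddf_sum [LHS](@monalgEw _ _ _ (msupp c)).
    by apply: eq_bigr => n _; rewrite cE hE.
  apply/fsubsetP => n; rewrite -!mcoeff_neq0 cE; apply: contra_neq => hn.
  by have := hE n; rewrite hn raddf0 => /esym/eqP; rewrite monalgU_eq0 => /eqP.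
move=> c' [c'gr xE]; apply/malgP => n; rewrite cE; apply: f_inj; rewrite hE.
apply/malgP => k; rewrite mcoeffU; case: eqVneq => [<-|nk]; last first.
  by rewrite (proj1 (grP _ _) (c'gr n)) // eq_sym.
rewrite [in LHS]xE !raddf_sum /=.
case: (msuppP c' n) => [c'n|].
  rewrite (big_fsetD1 n) //= big1_fset ?addr0 // => j; rewrite in_fsetD1.
  by case/andP => jn _ _; rewrite (proj1 (grP _ _) (c'gr j)) // eq_sym.
move=> nc'; rewrite raddf0 mcoeff0 big1_fset // => j jc' _.
rewrite (proj1 (grP _ _) (c'gr j)) //.
by apply: contraNneq nc' => ->.
Qed.
End Gradings.

Section ReesGraded.
Context (R : comNzRingType) (s : nat) (D : addrClosed (multideg s)).
Context (I : 'I_s -> ideal R) (F : filtration I).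

Fact rees_piece_subproof (n : multideg s) :
  let P (p : rees D I) := forall k, k != n -> (rees_val p)@_k = 0 in
  P 0 /\ forall a u v, P u -> P v -> P (a *: u + v).
Proof.
split=> [k _|a u v Pu Pv k kn]; first exact: (@mcoeff0 (multideg s) R k).
rewrite -[rees_val _]/(a *: rees_val u + rees_val v).
by rewrite mcoeffD mcoeffZ Pu // Pv // mulr0 addr0.
Qed.

Definition rees_piece n : submodClosed (rees D I) :=
  submod_of_set (rees_piece_subproof n).

Lemma rees_pieceP n (p : rees D I) :
  reflect (forall k, k != n -> (rees_val p)@_k = 0) (p \in rees_piece n).
Proof. exact: (submod_of_setP (rees_piece_subproof n)). Qed.

Fact rees_piece1 : 1 \in rees_piece 0.
Proof.
by apply/rees_pieceP => k k0; rewrite rmorph1 mcoeffU eq_sym (negPf k0).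
Qed.

Fact rees_pieceM m n (p q : rees D I) :
  p \in rees_piece m -> q \in rees_piece n -> p * q \in rees_piece (m + n).
Proof.
move=> /rees_pieceP pm /rees_pieceP qn; apply/rees_pieceP => k kmn.
rewrite rmorphM mcoeff_laurentM big1 // => i _; rewrite big1 // => j _.
case: eqP => // ij; rewrite mulr1n.
have [im|im] := eqVneq i m; last by rewrite pm ?mul0r.
rewrite qn ?mulr0 //; apply: contraNneq kmn => jn.
by rewrite -ij im jn.
Qed.

Fact rees_direct : direct_sum (fun n (p : rees D I) => p \in rees_piece n).
Proof.
apply: (@direct_sum_laurent _ _ _ (@rees_val R s D I)).
- exact: val_inj.
- by move=> n x; split=> /rees_pieceP.
move=> p n; have /asboolP Ip : rees_val p \in rees_pred D I by apply: valP.
suff cp : << (rees_val p)@_n *g n >> \in rees_pred D I by exists (Rees cp).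
apply/asboolP => k; rewrite mcoeffU; case: eqVneq => [<-|_].
  exact: Ip.
by split=> //; apply: ideal0.
Qed.

Definition rees_alg : gradedAlg R (multideg s) :=
  GradedAlg rees_piece1 rees_pieceM rees_direct.

Let MF := rees_module D F.

Fact rees_module_piece_subproof (n : multideg s) :
  let P (p : base_module (MF : lmodType rees_alg)) := forall k, k != n ->
    (submodule_val p : laurent R s)@_k = 0 in
  P 0 /\ forall a u v, P u -> P v -> P (a *: u + v).
Proof.
split=> [k _|a u v Pu Pv k kn]; first exact: (@mcoeff0 (multideg s) R k).
have -> : submodule_val (a *: u + v : MF) =
    rees_val (a%:A : rees D I) * submodule_val u + submodule_val v :> laurent R s.
  exact: (submodule_val_is_linear (a%:A : rees D I) u v).
rewrite mcoeffD linearZ rmorph1 -scalerAl mul1r mcoeffZ.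
by rewrite Pu // Pv // mulr0 addr0.
Qed.

Definition rees_module_piece n :
    submodClosed (base_module (MF : lmodType rees_alg)) :=
  submod_of_set (rees_module_piece_subproof n).

Lemma rees_module_pieceP n (p : MF) :
  reflect (forall k, k != n -> (submodule_val p : laurent R s)@_k = 0)
    (p \in rees_module_piece n).
Proof. exact: (submod_of_setP (rees_module_piece_subproof n)). Qed.

Fact rees_module_scale m n (a : rees_alg) (p : MF) :
  a \in galg_piece rees_alg m -> p \in rees_module_piece n ->
  a *: p \in rees_module_piece (m + n).
Proof.
move=> /rees_pieceP am /rees_module_pieceP pn.
apply/rees_module_pieceP => k kmn.
rewrite rees_module_valZ mcoeff_laurentM big1 // => i _; rewrite big1 // => j _.
case: eqP => // ij; rewrite mulr1n.
have [im|im] := eqVneq i m; last by rewrite am ?mul0r.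
rewrite pn ?mulr0 //; apply: contraNneq kmn => jn.
by rewrite -ij im jn.
Qed.

Fact rees_module_direct :
  direct_sum (fun n (p : MF) => p \in rees_module_piece n).
Proof.
apply: (@direct_sum_laurent _ _ _
  (@submodule_val _ _ (rees_submod D F) : {additive MF -> laurent R s})).
- exact: val_inj.
- by move=> n x; split=> /rees_module_pieceP.
move=> p n.
have /submod_of_setP Fp : submodule_val p \in rees_submod D F by apply: valP.
suff cp : (<< (submodule_val p : laurent R s)@_n *g n >> : laurent_module D I)
    \in rees_submod D F by exists (Submodule cp).
apply/submod_of_setP => k; rewrite mcoeffU; case: eqVneq => [<-|_].
  exact: Fp.
by split=> //; apply: ideal0.
Qed.

Definition rees_gmod : gradedMod rees_alg :=
  GradedMod rees_module_scale rees_module_direct.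
End ReesGraded.

Section ReesIrrelevant.
Context (R : comNzRingType) (s : nat) (I : 'I_s -> ideal R).

Fact rees_pp_subproof :
  let P (p : (rees nneg I)^o) := forall n, ~ mle mone n ->
    (rees_val (p : rees nneg I))@_n = 0 in
  P 0 /\ forall a u v, P u -> P v -> P (a *: u + v).
Proof.
split=> [n _|a u v Pu Pv n en]; first exact: (@mcoeff0 (multideg s) R n).
have -> : rees_val (a *: u + v : (rees nneg I)^o) =
  rees_val a * rees_val u + rees_val v by [].
rewrite mcoeffD (Pv n en).
have /asboolP Ia : rees_val a \in rees_pred nneg I by apply: valP.
rewrite addr0 mcoeff_laurentM big1 // => k _; rewrite big1 // => l _.
case: eqP => // kl; rewrite mulr1n.
have [kD|kD] := boolP (k \in nneg); last by rewrite (Ia k).2 // mul0r.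
rewrite Pu ?mulr0 // => el; apply: en => i; rewrite -kl.
by apply: le_trans (el i) _; rewrite [leRHS]ffunE lerDr; apply: (forallP kD).
Qed.

(* R_++ : the sum of the I^n t^n over n >= e *)
Definition rees_pp : ideal (rees_alg nneg I) := submod_of_set rees_pp_subproof.
End ReesIrrelevant.

Section RatliffRush.
Context (R : comNzRingType) (s : nat) (I : 'I_s -> ideal R) (F : filtration I).

Lemma colon_filS (n : multideg s) k l (x : R) : (k <= l)%N ->
  x \in colon (F (n + mone *+ k)) (ideal_pow (F mone) k) ->
  x \in colon (F (n + mone *+ l)) (ideal_pow (F mone) l).
Proof.
move/subnK <-; elim: (l - k)%N => // j IH /IH/colonP xj; rewrite addSn.
apply/colonP; apply: ideal_mul_sub => a b ae be; rewrite mulrCA mulrSr addrA.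
by rewrite [_ + mone]addrC; apply/fil_mul/mem_ideal_mul => //; apply: xj.
Qed.

Fact ratliff_rush_subproof (n : multideg s) :
  let P (x : R^o) := exists2 k : nat, (1 <= k)%N &
    (x : R) \in colon (F (mpos n + mone *+ k)) (ideal_pow (F mone) k) in
  P 0 /\ forall a u v, P u -> P v -> P (a *: u + v).
Proof.
split=> [|a u v [k k1 uk] [l l1 vl]]; first by exists 1%N => //; apply: ideal0.
exists (maxn k l); first by rewrite leq_max k1.
apply: idealD; last by apply: colon_filS vl; rewrite leq_maxr.
by apply: idealMl; apply: colon_filS uk; rewrite leq_maxl.
Qed.

(* the union over k >= 1 of the ideals F(n^+ + k e) : F(e)^k *)
Definition ratliff_rush (n : multideg s) : ideal R :=
  submod_of_set (ratliff_rush_subproof n).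

Definition admissible : Prop :=
  (forall n, F n =i F (mpos n)) /\ finite_module (rees_module allZ F).
End RatliffRush.

(* Main.v *)
From HB Require Import structures.
From mathcomp Require Import all_boot all_order all_algebra finmap.
From mathcomp Require Import monalg boolp classical_sets cardinality.
Require Import Defs.

Set Implicit Arguments.
Unset Strict Implicit.
Unset Printing Implicit Defensive.

Import Order.TTheory GRing.Theory Num.Theory.
Local Open Scope ring_scope.

(** Write A for the Rees ring of I, J for the ideal R_++, M for the Rees module
of F, and E for a graded injective resolution of M. The elements of R that may
occur in degree n of the J-saturation of M are the r such that
J^k (r t^n) is contained in M for some k, and both sides of the isomorphism
are this set modulo F(n).

On the cohomology side, a J-torsion cocycle x of E^1 in degree n is the
differential of some y in E^0 of degree n, and J^k y lies in M for large k
because x is killed by J^k. The ideals I_i are primary to m and R has depth at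
least 2, so the degree e part of J contains a t^e and b t^e with a, b a regular
sequence. If a^k t^(ke) y = u and b^k t^(ke) y = v in M, then
b^k t^(ke) u = a^k t^(ke) v, so a^k divides the coefficient of u, and the
quotient r satisfies c y = c (r t^n) for all c in J^k
([cocycle_represented]). So x determines r modulo F(n), because y is unique up
to M and the torsion of E^0, and a t^e is a nonzerodivisor on Laurent
polynomials ([represents_boundary]). Conversely, the embedding of M into
R[t_1, ..., t_s] lets the augmentation extend to a map g into the injective
object E^0, and y = g(r t^n) produces a cocycle
([pp_multiplies_represents]).

On the Ratliff-Rush side, J^k is contained in the sum of the I^p t^p for
p >= ke, and I^p = I^(ke) I^(p - ke), so r F(e)^k inside F(n + ke) implies
J^k (r t^n) inside M. For the converse one needs F(e)^l, which may be larger
than I^(le), to be controlled by powers of I. This is where admissibility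
enters: finite generation over the extended Rees ring gives
F(le) = I^(ke) F(le - ke) for large l ([fil_eventually_factors]), whence
r F(e)^l is contained in F(n + ke) F(le - ke), inside F(n + le)
([ratliff_rush_transporter]).

The relation between x and r is a linear correspondence rather than a map in
either direction, since y and r both involve choices; it induces the
isomorphism by [isomorphic_subquotients]. *)

(** * Subquotients related by a linear correspondence *)

Section Correspondence.
Context (R : pzRingType) (V W : lmodType R).

(** A relation that is linear, total on A and onto A', and that matches B with
B', is single valued and injective modulo B and B': differences of related
pairs are related, so the last hypothesis applies to them. *)
Lemma isomorphic_subquotients (A B : submodClosed V) (A' B' : submodClosed W)
    (T : V -> W -> Prop) :
  (forall a u v u' v', T u u' -> T v v' -> T (a *: u + v) (a *: u' + v')) ->
  (forall u, u \in A -> exists2 u', u' \in A' & T u u') ->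
  (forall u', u' \in A' -> exists2 u, u \in A & T u u') ->
  (forall u u', u \in A -> u' \in A' -> T u u' -> (u \in B) = (u' \in B')) ->
  isomorphic (subquotient A B) (subquotient A' B').
Proof.
move=> Tlin Tl Tr TB.
have /choice[h hT] : forall u : submodule A, exists u' : submodule A',
    T (submodule_val u) (submodule_val u').
  by case=> u Au; have [u' Au' Tu] := Tl u Au; exists (Submodule Au').
have /choice[k kT] : forall u' : submodule A', exists u : submodule A,
    T (submodule_val u) (submodule_val u').
  by case=> u' Au'; have [u Au Tu] := Tr u' Au'; exists (Submodule Au).
have pair_eq (u v : submodule A) (u' v' : submodule A') :
    T (submodule_val u) (submodule_val u') ->
    T (submodule_val v) (submodule_val v') ->
    quot_proj (trace_submod A B) u = quot_proj (trace_submod A B) v <->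
    quot_proj (trace_submod A' B') u' = quot_proj (trace_submod A' B') v'.
  move=> Tu Tv.
  have Tuv : T (submodule_val (u - v)) (submodule_val (u' - v')).
    rewrite !raddfB /= addrC [X in T _ X]addrC -!scaleN1r.
    exact: Tlin.
  have TBuv := TB _ _ (valP (u - v)) (valP (u' - v')) Tuv.
  rewrite !quot_projE.
  by split=> /submod_of_setP Buv; apply/submod_of_setP; rewrite ?TBuv // -TBuv.
pose f (q : subquotient A B) : subquotient A' B' :=
  quot_proj (trace_submod A' B') (h (repr (q : Quotient.quot _))).
have reprE (q : subquotient A B) :
    quot_proj (trace_submod A B) (repr (q : Quotient.quot _)) = q.
  by rewrite /quot_proj reprK.
have fE u u' : T (submodule_val u) (submodule_val u') ->
    f (quot_proj (trace_submod A B) u) = quot_proj (trace_submod A' B') u'.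
  by move=> Tu; apply/(pair_eq _ _ _ _ (hT _) Tu); rewrite reprE.
have f_lin : linear f.
  move=> a p q; have [u ->] := quot_proj_surj p; have [v ->] := quot_proj_surj q.
  have quotP (C : lmodType R) (N : submodClosed C) b (x y : C) :
      b *: quot_proj N x + quot_proj N y = quot_proj N (b *: x + y).
    by rewrite raddfD -[b *: _]/(quot_scale b _) quot_scaleE.
  rewrite (fE _ _ (hT u)) (fE _ _ (hT v)) !quotP.
  by apply: fE; rewrite !linearP; apply: Tlin; apply: hT.
pose fL : {linear subquotient A B -> subquotient A' B'} :=
  HB.pack f (GRing.isLinear.Build _ _ _ _ f f_lin).
exists fL; apply: (@Bijective _ _ fL (fun q : subquotient A' B' =>
  quot_proj (trace_submod A B) (k (repr (q : Quotient.quot _))) :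
    subquotient A B)) => q.
  have [u ->] := quot_proj_surj q; rewrite /= (fE _ _ (hT u)).
  by apply/(pair_eq _ _ _ _ (kT _) (hT u)); rewrite /quot_proj reprK.
have [u' ->] := quot_proj_surj q; rewrite /= (fE _ _ (kT _)).
by rewrite /quot_proj reprK.
Qed.
End Correspondence.

(** * Homogeneous preimages *)

Section Gradings.
Context (R : comNzRingType) (G : zmodType) (A : gradedAlg R G).

(** The preimage is the degree n component of y: the images of the components
of y are the components of f y, by uniqueness of the decomposition. *)
Lemma degree0_lift (M N : gradedMod A) (f : {linear M -> N}) (n : G) (y : M) :
  degree0 f -> f y \in gmod_piece N n ->
  exists2 y' : M, y' \in gmod_piece M n & f y' = f y.
Proof.
move=> f0 fyn.
have [c [[cM yE] _]] := gmod_direct y.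
have [c' [[c'N fyE] c'U]] := gmod_direct (f y).
pose e : {malg N[G]} := [malg k in msupp c => f c@_k].
have eE k : e@_k = f c@_k.
  rewrite mcoeffE; case: ifPn => // /mcoeff_outdom ->.
  by rewrite raddf0.
have ec' : c' = e.
  apply: c'U; split; first by move=> k; rewrite eE; apply/f0/cM.
  rewrite [in LHS]yE raddf_sum.
  have se : (msupp e `<=` msupp c)%fset.
    apply/fsubsetP => k; rewrite -!mcoeff_neq0 eE; apply: contra_neq => ->.
    exact: raddf0.
  rewrite [RHS](big_fset_incl _ se) /=.
    by apply: eq_bigr => k _; rewrite eE.
  by move=> k _ /mcoeff_outdom.
have : c' = << f y *g n >>.
  apply: c'U; split=> [k|].
    rewrite mcoeffU; case: eqVneq => [<-|_] //; exact: (rpred0 (gmod_piece N k)).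
  rewrite (big_fset_incl _ (@msuppU_le _ _ _ _)) /=; last first.
    by move=> k _ /mcoeff_outdom.
  by rewrite big_seq_fset1 mcoeffUU.
rewrite ec' => /(congr1 (mcoeff n)); rewrite eE mcoeffUU => fc.
by exists c@_n.
Qed.
End Gradings.

(** * Monomials in the Laurent polynomials *)

Section Monomials.
Context (R : comNzRingType) (s : nat).
Implicit Types (p q : laurent R s) (k n : multideg s).

Lemma mcoeff_laurentMU p r k n : (p * << r *g k >>)@_n = p@_(n - k) * r.
Proof.
rewrite -[p * _]/(laurent_mul _ _) (laurent_mulw (fsubset_refl _) msuppU_le).
rewrite raddf_sum /=.
under eq_bigr do rewrite big_seq_fset1 mcoeffUU mcoeffU.
case: (msuppP p (n - k)) => [pnk|nsupp].
  rewrite (big_fsetD1 (n - k)) //= subrK eqxx mulr1n big1_fset ?addr0 // => j.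
  rewrite in_fsetD1 => /andP[jn _] _; case: eqP => // jkn.
  by rewrite -jkn addrK eqxx in jn.
rewrite mul0r big1_fset // => j jp _; case: eqP => // jkn.
by rewrite -jkn addrK jp in nsupp.
Qed.

Lemma laurent_monomialM (a b : R) k n :
  (<< a *g k >> : laurent R s) * << b *g n >> = << a * b *g k + n >>.
Proof. exact: laurent_mulUU. Qed.

Lemma laurent_monomial_lreg (a : R) k p q :
  (forall z : R, z * a = 0 -> z = 0) ->
  (<< a *g k >> : laurent R s) * p = (<< a *g k >> : laurent R s) * q -> p = q.
Proof.
move=> areg; rewrite ![(<< a *g k >> : laurent R s) * _]mulrC => pq; apply/malgP => n.
have := congr1 (mcoeff (n + k)) pq; rewrite !mcoeff_laurentMU addrK.
by move/eqP; rewrite -subr_eq0 -mulrBl => /eqP/areg/eqP; rewrite subr_eq0 => /eqP.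
Qed.

Lemma mcoeff_laurentUM p r k n :
  ((<< r *g k >> : laurent R s) * p)@_(k + n) = p@_n * r.
Proof. by rewrite mulrC mcoeff_laurentMU [k + n]addrC addrK. Qed.

Lemma laurent_monomialZ (a b : R) k :
  << a * b *g k >> = a *: (<< b *g k >> : laurent R s).
Proof. by apply/malgP => n; rewrite mcoeffZ !mcoeffU mulrnAr. Qed.
End Monomials.

(** * Regular pairs *)

Section RegularPairs.
Context (R : comNzRingType).

Definition regular_pair (x y : R) : Prop :=
  (forall z, z * x = 0 -> z = 0) /\
  (forall z w, z * y = w * x -> exists v, z = v * x).

(** If z y = w x^(k+1), then x divides z since y is regular modulo x; cancelling
x, which is a nonzerodivisor, lowers the exponent by one. *)
Lemma regular_pairXl x y k : regular_pair x y -> regular_pair (x ^+ k) y.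
Proof.
case=> xreg yreg; elim: k => [|k [IHx IHy]].
  by split=> [z|z w _]; [rewrite mulr1 | exists z; rewrite mulr1].
split=> [z|z w].
  by rewrite exprSr mulrA => /xreg/IHx.
rewrite exprSr mulrA => zy; have [v zE] := yreg _ _ zy.
have /IHy[u vE] : v * y = w * x ^+ k.
  apply/eqP; rewrite -subr_eq0; apply/eqP/xreg.
  by rewrite mulrBl -zy zE mulrAC subrr.
by exists u; rewrite zE vE mulrA.
Qed.

Lemma regular_pairXr x y k : regular_pair x y -> regular_pair x (y ^+ k).
Proof.
case=> xreg yreg; split=> //; elim: k => [|k IH] z w.
  by rewrite mulr1 => ->; exists w.
by rewrite exprSr mulrA => /yreg[v /IH].
Qed.

Lemma depth_regular_pair (m : ideal R) d : has_depth m d -> (2 <= d)%N ->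
  exists x y : R, [/\ x \in m, y \in m & regular_pair x y].
Proof.
move=> [[[|x [|y xs]] [[xsm reg _] <-]] _] // _.
exists x, y; split; [by apply: xsm; rewrite inE eqxx|
                     by apply: xsm; rewrite !inE eqxx orbT|split].
  move=> z zx.
  have gen0 (v : R^o) : v \in gen_submod [set` ([::] : seq R^o)] -> v = 0.
    have sub0 : (0 : R^o) = 0 /\
        forall (a : R) (u v : R^o), u = 0 -> v = 0 -> a *: u + v = 0.
      by split=> // a _ _ -> ->; rewrite scaler0 addr0.
    move=> v0; apply/(@submod_of_setP _ _ (fun v : R^o => v = 0) sub0).
    by apply: gen_submod_sub v0 => u /=; rewrite inE.
  by apply/gen0/(reg 0%N) => //; rewrite [z * _]zx; apply: ideal0.
move=> z w zy.
have genx (v : R^o) : v \in gen_submod [set` ([:: x] : seq R^o)] <->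
    exists t : R, v = t * x.
  have subx : (exists t : R, (0 : R) = t * x) /\
      forall (a : R) (u v : R^o), (exists t : R, u = t * x) ->
        (exists t : R, v = t * x) -> exists t : R, a *: u + v = t * x.
    split=> [|a u v' [t ->] [t' ->]]; first by exists 0; rewrite mul0r.
    by exists (a * t + t'); rewrite mulrDl -mulrA.
  split=> [vx|[t ->]].
    apply/(@submod_of_setP _ _ (fun v : R^o => exists t : R, v = t * x) subx).
    apply: (@gen_submod_sub _ _ _ (submod_of_set subx) _ v vx) => u ux.
    have -> : u = x by apply/eqP; rewrite -mem_seq1.
    refine (introT (submod_of_setP subx x) _).
    by exists 1; rewrite mul1r.
  apply: (@rpredZ _ R^o _ t x); apply: mem_gen_submod.
  by rewrite /= inE eqxx.
by apply/genx/(reg 1%N) => //; apply/genx; exists w.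
Qed.
End RegularPairs.

(** * Products of powers of ideals *)

Lemma mle_subr_nneg s (p q : multideg s) : mle p q -> q - p \in nneg.
Proof. by move=> pq; apply/forallP => i; rewrite !ffunE subr_ge0. Qed.

Lemma mone_nneg s k : (mone *+ k : multideg s) \in nneg.
Proof. by rewrite rpredMn //; apply/forallP => i; rewrite ffunE. Qed.

Section Multipow.
Context (R : comNzRingType).
Implicit Types (J K L : ideal R).

Lemma ideal_mul_mono J K J' K' : {subset J <= J'} -> {subset K <= K'} ->
  {subset ideal_mul J K <= ideal_mul J' K'}.
Proof.
move=> JJ' KK'; apply: gen_submod_sub => _ [x [y [/JJ' Jx /KK' Ky ->]]].
exact: mem_ideal_mul.
Qed.

Lemma ideal_powD J k l :
  {subset ideal_pow J (k + l) <= ideal_mul (ideal_pow J k) (ideal_pow J l)}.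
Proof.
elim: k => [|k IH] v.
  move=> Jv; rewrite -(mul1r v); apply: mem_ideal_mul => //.
  exact: (mem_full_submod (1 : R^o)).
rewrite addSn => Jv; rewrite -(mul1r v); move: v Jv.
apply: ideal_mul_sub => a b Ja /IH Jb; rewrite mul1r.
move: b Jb; apply: ideal_mul_sub => b c Jb Jc; rewrite mulrA.
by do 2?apply: mem_ideal_mul.
Qed.

Lemma ideal_pow_sub J K k :
  {subset J <= K} -> {subset ideal_pow J k <= ideal_pow K k}.
Proof. by move=> JK; elim: k => // k IH; apply: ideal_mul_mono. Qed.

Lemma mem_ideal_powX J (x : R) k : x \in J -> x ^+ k \in ideal_pow J k.
Proof.
move=> Jx; elim: k => [|k IH]; first exact: (mem_full_submod (1 : R^o)).
by rewrite exprS; apply: mem_ideal_mul.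
Qed.

Context (s : nat) (I : 'I_s -> ideal R).
Implicit Types p q : multideg s.

(** Nonnegativity matters: nonpositive powers are R, so the inclusion can
fail for p and q of opposite signs. *)
Lemma multipowD p q : p \in nneg -> q \in nneg ->
  {subset multipow I (p + q) <= ideal_mul (multipow I p) (multipow I q)}.
Proof.
move=> /forallP p0 /forallP q0; rewrite /multipow.
pose K3 J K L := {subset J <= ideal_mul K L}.
apply: (big_rec3 (fun K L J => K3 J K L)) => [v _|i K L J _ IH v].
  rewrite -(mulr1 v); apply: mem_ideal_mul; exact: mem_full_submod.
move=> Jv; rewrite -(mul1r v); move: v Jv; apply: ideal_mul_sub => a b.
have -> : `|mpos (p + q)%R i|%N = (`|mpos p i| + `|mpos q i|)%N.
  rewrite !ffunE !max_l ?addr_ge0 ?p0 ?q0 //; have := p0 i; have := q0 i.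
  by case: (p i) => // a1; case: (q i) => // a2.
move=> /ideal_powD aI /IH bJ; rewrite mul1r.
move: b bJ; apply: ideal_mul_sub => b b' bK b'L; rewrite [a * _]mulrC.
move: a aI; apply: ideal_mul_sub => a a' aI a'I.
by rewrite mulrC mulrACA; do 2?apply: mem_ideal_mul.
Qed.

Lemma multipow_mone k :
  {subset multipow I (mone *+ k) <= ideal_pow (multipow I mone) k}.
Proof.
elim: k => [|k IH] v vI; first exact: mem_full_submod.
move: vI; rewrite mulrS => /(multipowD (mone_nneg s 1) (mone_nneg s k)).
exact: ideal_mul_mono.
Qed.

Lemma mem_multipowX (x : R) p :
  (forall i, x \in I i) -> x ^+ (\sum_i `|mpos p i|)%N \in multipow I p.
Proof.
move=> xI; rewrite /multipow; pose K2 J (k : nat) := x ^+ k \in J.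
apply: (big_rec2 K2) => [|i J k _ IH]; first exact: (mem_full_submod (1 : R^o)).
by rewrite /K2 exprD; apply: mem_ideal_mul => //; apply: mem_ideal_powX.
Qed.
End Multipow.

(** * Powers of the ideal R_++ *)

Section ReesPowers.
Context (R : comNzRingType) (s : nat) (I : 'I_s -> ideal R).
Local Notation A := (rees_alg nneg I).
Local Notation J := (rees_pp I).
Implicit Types (n p q : multideg s) (c : A).

Lemma rees_coef (D : addrClosed (multideg s)) (a : rees D I) n :
  (rees_val a)@_n \in multipow I n /\ (n \notin D -> (rees_val a)@_n = 0).
Proof. by have /asboolP := valP a. Qed.

Lemma rees_ppP c :
  reflect (forall n, ~ mle mone n -> (rees_val c)@_n = 0) (c \in J).
Proof. exact: (submod_of_setP (rees_pp_subproof I)). Qed.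

Fact rees_above_subproof q :
  let P (c : A^o) := forall n, ~ mle q n -> (rees_val (c : A))@_n = 0 in
  P 0 /\ forall a u v, P u -> P v -> P (a *: u + v).
Proof.
split=> [n _|a u v Pu Pv n qn]; first exact: (@mcoeff0 (multideg s) R n).
have -> : rees_val (a *: u + v : A^o) = rees_val a * rees_val u + rees_val v by [].
rewrite mcoeffD (Pv n qn) addr0 mcoeff_laurentM big1 // => k _.
rewrite big1 // => l _; case: eqP => // kl; rewrite mulr1n.
have [kD|kD] := boolP (k \in nneg); last by rewrite (rees_coef a k).2 // mul0r.
rewrite Pu ?mulr0 // => ql; apply: qn => i; rewrite -kl.
by apply: le_trans (ql i) _; rewrite [leRHS]ffunE lerDr; apply: (forallP kD).
Qed.

Lemma rees_pp_pow_coef k c n : c \in ideal_pow J k -> ~ mle (mone *+ k) n ->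
  (rees_val c)@_n = 0.
Proof.
pose K q : ideal A := submod_of_set (rees_above_subproof q).
have KP q d : reflect (forall n, ~ mle q n -> (rees_val d)@_n = 0) (d \in K q).
  exact: (submod_of_setP (rees_above_subproof q)).
suff JK : {subset ideal_pow J k <= K (mone *+ k)} by move/JK/KP; apply.
elim: k {c} => [|k IH] c.
  move=> _; apply/KP => {}n n0; apply: (rees_coef c n).2.
  by apply/negP => /forallP nn; apply: n0 => i; rewrite !ffunE.
move=> cJ; rewrite -(mul1r c); move: c cJ; apply: ideal_mul_sub => a b.
move=> /rees_ppP a1 /IH/KP bk; rewrite mul1r; apply/KP => {}n kn.
rewrite rmorphM mcoeff_laurentM big1 // => i _; rewrite big1 // => j _.
case: eqP => // ij; rewrite mulr1n.
have [ei|/a1->] := EM (mle mone i); last by rewrite mul0r.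
rewrite bk ?mulr0 // => kj; apply: kn => t.
by rewrite -ij mulrS ![(_ + _ : multideg s) t]ffunE lerD.
Qed.

Lemma rees_monomial_subproof n (r : R) : n \in nneg -> r \in multipow I n ->
  (<< r *g n >> : laurent R s) \in rees_pred nneg I.
Proof.
move=> nn rI; apply/asboolP => k; rewrite mcoeffU.
case: eqVneq => [<-|_]; first by rewrite nn.
by split=> //; apply: ideal0.
Qed.

Definition rees_monomial n (r : R) (nn : n \in nneg) (rI : r \in multipow I n) : A :=
  Rees (rees_monomial_subproof nn rI).

(** An element r of (I^e)^k is a sum of products, so r t^(ke) need not be a
product of elements of R_++; hence the induction first checks that the claim is
stable under linear combinations. *)
Lemma rees_pp_pow_monomial k (r : R) : r \in ideal_pow (multipow I mone) k ->
  exists2 c : A, c \in ideal_pow J k & rees_val c = << r *g (mone *+ k) >>.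
Proof.
have sub j : let P (x : R^o) := exists2 c : A, c \in ideal_pow J j &
      rees_val c = << (x : R) *g (mone *+ j) >> in
    P 0 /\ forall a u v, P u -> P v -> P (a *: u + v).
  split=> [|a u v [c cJ cE] [d dJ dE]].
    by exists 0; [exact: ideal0 | rewrite raddf0 monalgU0].
  exists (a%:A * c + d); first by apply: idealD => //; apply: idealMl.
  rewrite mulr_algl -[LHS]/(a *: rees_val c + rees_val d) cE dE.
  by rewrite monalgUD laurent_monomialZ.
elim: k r => [|k IH] r.
  exists (r%:A); first exact: (mem_full_submod (r%:A : A^o)).
  by rewrite -[LHS]/(r *: (<< 1 *g 0 >> : laurent R s)) -laurent_monomialZ mulr1.
move=> rI; apply: (elimT (submod_of_setP (sub k.+1) r)).
apply: (@gen_submod_sub _ R^o _ (submod_of_set (sub k.+1)) _ r rI).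
move=> _ [x [y [xI /IH[c cJ cE] ->]]].
apply: (introT (submod_of_setP (sub k.+1) (x * y))).
exists (rees_monomial (mone_nneg s 1) xI * c).
  apply: mem_ideal_mul => //; apply/rees_ppP => n en.
  by rewrite mcoeffU; case: eqVneq => // en'; case: en; rewrite -en'.
by rewrite rmorphM /= [X in _ * X]cE laurent_monomialM -mulrS.
Qed.

Lemma rees_pp_pow_powerX (u : R) k : u \in multipow I mone ->
  exists2 c : A, c \in ideal_pow J k & rees_val c = << u ^+ k *g (mone *+ k) >>.
Proof. by move=> uI; apply/rees_pp_pow_monomial/mem_ideal_powX. Qed.
End ReesPowers.

(** * Finitely generated filtrations *)

Section FiniteFiltration.
Context (R : comNzRingType) (s : nat) (I : 'I_s -> ideal R) (F : filtration I).
Implicit Types (n p q : multideg s).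

(** The degree p part of the submodule of the extended Rees module of F that is
generated by the homogeneous elements whose degree is at most Be. *)
Definition low_degree_span (B : nat) p : ideal R :=
  gen_submod [set z : R^o | exists j a b, [/\ mle j (mone *+ B),
    a \in multipow I (p - j), b \in F j & z = (a : R) * b]].

Lemma low_degree_spanM B p q (x z : R) : x \in multipow I p ->
  z \in low_degree_span B q -> x * z \in low_degree_span B (p + q).
Proof.
move=> xI.
pose K : ideal R := submod_of_set (scaled_subproof (low_degree_span B (p + q)) x).
suff zK : {subset low_degree_span B q <= K} by move/zK/submod_of_setP.
apply: gen_submod_sub => _ [j [a [b [jB aI bF ->]]]].
apply/(submod_of_setP (scaled_subproof (low_degree_span B (p + q)) x)).
apply: mem_gen_submod; exists j, (x * a), b; split=> //; last exact: mulrA.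
by rewrite -addrA; apply: multipowM.
Qed.

Lemma support_bound (X : seq (laurent R s)) :
  exists B : nat, forall (v : laurent R s) j,
    v \in X -> j \in msupp v -> mle j (mone *+ B).
Proof.
elim: X => [|v X [B XB]]; first by exists 0%N.
pose C := (\max_(j <- msupp v) \max_(i < s) `|j i|)%N.
exists (maxn B C) => w j; rewrite inE => /orP[/eqP-> jv|wX jw] i.
  have jC : (`|j i| <= C)%N.
    by rewrite /C (big_fsetD1 j) //= leq_max (leq_bigmax i).
  rewrite ffunMnE ffunE natz; apply: le_trans (ler_norm _) _.
  by rewrite -abszE lez_nat leq_max jC orbT.
apply: le_trans (XB w j wX jw i) _; rewrite !ffunMnE !ffunE !natz.
by rewrite lez_nat leq_maxl.
Qed.

(** Take B at least every exponent in the generators of the Rees module. The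
elements with all coefficients in [low_degree_span B] form a submodule which
contains the generators, hence everything. *)
Lemma fil_low_degree : finite_module (rees_module allZ F) ->
  exists B, forall p, {subset F p <= low_degree_span B p}.
Proof.
move=> [X Xgen].
have [B XB] := support_bound (map (@submodule_val _ _ (rees_submod allZ F)) X).
exists B => p z zF.
have sub : let P (v : rees_module allZ F) :=
      forall q, (submodule_val v : laurent R s)@_q \in low_degree_span B q in
    P 0 /\ forall a u v, P u -> P v -> P (a *: u + v).
  split=> [q|a u v Pu Pv q]; first by rewrite mcoeff0; apply: ideal0.
  rewrite [submodule_val _]/(submodule_val (a *: u) + submodule_val v).
  rewrite mcoeffD; apply: idealD => //.
  rewrite rees_module_valZ mcoeff_laurentM.
  apply: (@rpred_sum _ (low_degree_span B q)) => k _.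
  apply: (@rpred_sum _ (low_degree_span B q)) => l _.
  case: eqP => [<-|_]; last exact: ideal0.
  by apply: low_degree_spanM => //; apply: (rees_coef a k).1.
have zP : (<< z *g p >> : laurent_module allZ I) \in rees_submod allZ F.
  apply/submod_of_setP => q; rewrite mcoeffU.
  by case: eqVneq => [<-|_]; split=> //; apply: ideal0.
have := mem_full_submod (Submodule zP); rewrite Xgen => zX.
have /submod_of_setP/(_ p) : Submodule zP \in submod_of_set sub.
  apply: gen_submod_sub zX => v vX; apply: (introT (submod_of_setP sub v)) => q.
  have /submod_of_setP/(_ q)[vF _] : submodule_val v \in rees_submod allZ F
    by apply: valP.
  case: (msuppP (submodule_val v : laurent R s) q) => [qv|_]; last exact: ideal0.
  (* a generator: its coefficient in degree q comes with the scalar 1 in I^0 *)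
  apply: mem_gen_submod; exists q, 1, (submodule_val v : laurent R s)@_q; split=> //.
  - by apply: XB qv; apply: map_f.
  - by rewrite subrr; apply: multipow0.
  - by rewrite mul1r.
by rewrite mcoeffUU.
Qed.

(** With l = k + B, a generator of degree j <= Be is multiplied in degree le by
an element of I^(le - j), and le - j exceeds ke by the nonnegative degree
Be - j, so that I^(ke) splits off. *)
Lemma fil_eventually_factors : finite_module (rees_module allZ F) -> forall k,
  exists2 l, (k <= l)%N & {subset F (mone *+ l) <=
    ideal_mul (multipow I (mone *+ k)) (F (mone *+ (l - k)))}.
Proof.
move=> /fil_low_degree[B FB] k; exists (k + B)%N; first exact: leq_addr.
move=> z /FB; rewrite addKn; apply: gen_submod_sub => _ [j [a [b [jB aI bF ->]]]].
move: aI; rewrite mulrnDr -addrA.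
move=> /(multipowD (mone_nneg s k) (mle_subr_nneg jB)) aI.
rewrite mulrC; move: a aI; apply: ideal_mul_sub => a a' aI a'I.
rewrite mulrC -mulrA; apply: mem_ideal_mul => //.
by rewrite -(subrK j (mone *+ B)); apply/fil_mul/mem_ideal_mul/bF; apply: fil_pow.
Qed.
End FiniteFiltration.

(** * The Ratliff-Rush closure as a saturation *)

Section Saturation.
Context (R : comNzRingType) (s : nat) (I : 'I_s -> ideal R) (F : filtration I).
Local Notation A := (rees_alg nneg I).
Local Notation J := (rees_pp I).

Definition pp_multiplies_into k (r : R) (n : multideg s) : Prop :=
  forall c : A, c \in ideal_pow J k ->
    (rees_val c * << r *g n >> : laurent_module nneg I) \in rees_submod nneg F.

Lemma rees_submodP D (v : laurent_module D I) :
  reflect (forall n, (v : laurent R s)@_n \in F n /\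
                     (n \notin D -> (v : laurent R s)@_n = 0))
    (v \in rees_submod D F).
Proof. exact: (submod_of_setP (rees_module_subproof D F)). Qed.

(** Both conditions say that a large power of an ideal multiplies r into F: powers
of F(e) for the closure, powers of I^e for R_++. Powers of I^e are the smaller
ones; conversely, F(e)^l lies in I^(ke) F(le - ke) for large l. *)
Lemma ratliff_rush_transporter (n : multideg s) (r : R) :
  finite_module (rees_module allZ F) -> n \in nneg ->
  r \in ratliff_rush F n <-> exists k, pp_multiplies_into k r n.
Proof.
move=> Ffin nn.
have posn : mpos n = n.
  by apply/ffunP => i; rewrite ffunE max_l //; apply: (forallP nn).
have IF k : {subset multipow I (mone *+ k) <= ideal_pow (F mone) k}.
  move=> z /multipow_mone; apply: ideal_pow_sub; exact: fil_pow.
split=> [/(submod_of_setP (ratliff_rush_subproof F n))[k _]|[k rk]].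
  rewrite posn => /colonP rF; exists k => c cJ; apply/rees_submodP => q.
  rewrite mcoeff_laurentMU; have [cI c0] := rees_coef c (q - n).
  split=> [|qn]; last first.
    rewrite c0 ?mul0r //; apply: contraNN qn => qn.
    by rewrite -(subrK n q) rpredD.
  have [kq|/(rees_pp_pow_coef cJ)->] := EM (mle (mone *+ k) (q - n)); last first.
    by rewrite mul0r; apply: ideal0.
  have qk := mle_subr_nneg kq.
  rewrite -[X in multipow I X](subrKC (mone *+ k)) in cI.
  move/(multipowD (mone_nneg s k) qk): cI; rewrite [_ * r]mulrC.
  apply: ideal_mul_sub => a b /IF aF bI.
  have -> : q = (n + mone *+ k) + (q - n - mone *+ k) by rewrite -addrA !subrKC.
  rewrite mulrA; apply/fil_mul/mem_ideal_mul; first exact: rF.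
  exact: fil_pow.
(* k + 1 instead of k makes the exponent l positive *)
have [l kl Fl] := fil_eventually_factors Ffin k.+1.
apply/(submod_of_setP (ratliff_rush_subproof F n)).
exists l; first exact: leq_trans kl.
rewrite posn; apply/colonP => y yF.
have {yF}/Fl : y \in F (mone *+ l).
  have := fil_mul; elim: (l) y yF => [|j IH] y yF mulF.
    by apply: fil_pow; rewrite mulr0n; apply: multipow0.
  rewrite mulrS; apply/mulF; move: y yF; apply: ideal_mul_mono => // z zF.
  exact: IH.
rewrite -(subnKC kl) addKn mulrnDr addrA.
apply: ideal_mul_sub => a b aI bF; rewrite mulrA.
apply/fil_mul/mem_ideal_mul => //.
have [c cJ cE] := @rees_pp_pow_monomial R s I k.+1 a (multipow_mone aI).
have /rees_submodP/(_ (n + mone *+ k.+1))[+ _] := rk c (ideal_powS (leqnSn k) cJ).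
by rewrite cE mcoeff_laurentMU [n + _]addrC addrK mcoeffUU mulrC.
Qed.
End Saturation.

(** * The embedding into the polynomial ring *)

Section Ambient.
Context (R : comNzRingType) (s : nat) (I : 'I_s -> ideal R).

(** Its Rees module over the nonnegative degrees is R[t_1, ..., t_s], seen as a
module over the Rees ring of I. *)
Definition unit_filtration : filtration I :=
  @Filtration R s I (fun _ => full_submod R^o)
    (fun _ v _ => mem_full_submod v) (fun _ _ v _ => mem_full_submod v)
    (fun _ _ _ v _ => mem_full_submod v).

Context (F : filtration I).
Local Notation M := (rees_module nneg F).
Local Notation L := (rees_module nneg unit_filtration).

Fact rees_embed_subproof (v : M) :
  submodule_val v \in rees_submod nneg unit_filtration.
Proof.
have /rees_submodP vF : submodule_val v \in rees_submod nneg F by apply: valP.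
by apply/rees_submodP => n; split; [exact: mem_full_submod | exact: (vF n).2].
Qed.

Definition rees_embed (v : M) : L := Submodule (rees_embed_subproof v).

Fact rees_embed_is_linear : linear rees_embed.
Proof.
move=> a u v; apply: val_inj.
rewrite [LHS](submodule_val_is_linear a u v).
by rewrite [RHS](submodule_val_is_linear a (rees_embed u) (rees_embed v)).
Qed.

HB.instance Definition _ :=
  GRing.isLinear.Build (rees nneg I) M L _ rees_embed rees_embed_is_linear.

Lemma rees_embed_inj : injective rees_embed.
Proof. by move=> u v /(congr1 (@submodule_val _ _ _)) uv; apply: val_inj. Qed.

Lemma rees_embed_degree0 :
  @degree0 R _ _ (rees_gmod nneg F) (rees_gmod nneg unit_filtration) rees_embed.
Proof. by move=> n v /rees_module_pieceP vn; apply/rees_module_pieceP. Qed.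
End Ambient.

(** * First local cohomology *)

Section FirstLocalCohomology.
Context (R : comNzRingType) (s : nat) (I : 'I_s -> ideal R) (F : filtration I).
Context (E : injective_resolution (rees_gmod nneg F)).
Local Notation A := (rees_alg nneg I).
Local Notation J := (rees_pp I).
Local Notation M := (rees_gmod nneg F).
Local Notation L := (rees_gmod nneg (unit_filtration I)).

Context (n : multideg s) (nn : n \in nneg).
Context (a b : R) (aI : a \in multipow I mone) (bI : b \in multipow I mone).
Hypothesis ab_reg : regular_pair a b.

(** Up to torsion, y behaves like r t^n, although the two live in different
modules: a power of R_++ carries both to the same elements of M. *)
Definition represents_via (y : E 0) (r : R) : Prop :=
  exists k, forall c : A, c \in ideal_pow J k ->
    exists2 v : M, c *: y = res_aug E v &
      submodule_val v = rees_val c * << r *g n >> :> laurent R s.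

Definition represents (x : E 1) (r : R) : Prop :=
  exists2 y : E 0, res_diff E 0 y = x & represents_via y r.

Lemma torsionP (i : nat) (x : E i) :
  reflect (exists k, forall c : A, c \in ideal_pow J k -> c *: x = 0)
    (x \in torsion J (E i)).
Proof. exact: (submod_of_setP (torsion_subproof J (E i))). Qed.

Lemma cocyclesP (i : nat) (x : E i) :
  reflect [/\ x \in gmod_piece (E i) n, x \in torsion J (E i) & res_diff E i x = 0]
    (x \in cocycles J E i n).
Proof. exact: (submod_of_setP (cocycles_subproof J E i n)). Qed.

Lemma coboundariesP (x : E 1) :
  reflect (exists2 y : E 0, y \in torsion J (E 0) & x = res_diff E 0 y)
    (x \in coboundaries J E 1).
Proof. exact: (submod_of_setP (coboundaries_subproof J E 1)). Qed.

Lemma res_diff_aug (v : M) : res_diff E 0 (res_aug E v) = 0.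
Proof. by apply/res_exact0; exists v. Qed.

Lemma res_diff_diff i (x : E i) : res_diff E i.+1 (res_diff E i x) = 0.
Proof. by apply/res_exactS; exists x. Qed.

Lemma represents_linear (t : R) (x1 x2 : base_module (E 1)) (r1 r2 : R^o) :
  represents x1 r1 -> represents x2 r2 ->
  represents (t *: x1 + x2 : base_module (E 1)) (t *: r1 + r2).
Proof.
move=> [y1 <- [k1 y1r]] [y2 <- [k2 y2r]].
exists (t%:A *: y1 + y2); first by rewrite linearP.
exists (maxn k1 k2) => c cJ.
have [v1 y1v v1E] := y1r c (ideal_powS (leq_maxl _ _) cJ).
have [v2 y2v v2E] := y2r c (ideal_powS (leq_maxr _ _) cJ).
exists (t%:A *: v1 + v2).
  by rewrite scalerDr scalerA mulrC -scalerA y1v y2v linearP.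
have -> : submodule_val (t%:A *: v1 + v2 : M) =
    rees_val (t%:A : A) * submodule_val v1 + submodule_val v2 :> laurent R s.
  exact: (submodule_val_is_linear (t%:A : A) v1 v2).
have -> : rees_val (t%:A : A) = t%:A :> laurent R s by [].
rewrite v1E v2E.
by rewrite mulr_algl monalgUD laurent_monomialZ mulrDr scalerAr.
Qed.

(** The augmentation of M extends to R[t_1, ..., t_s] because E^0 is injective;
the image of r t^n under the extension plays the role of y. *)
Lemma pp_multiplies_represents (r : R) (k : nat) :
  pp_multiplies_into F k r n ->
  exists2 x : E 1, x \in cocycles J E 1 n & represents x r.
Proof.
move=> rF.
have [g [g0 gE]] := @res_injective _ _ _ _ E 0 M L (@rees_embed _ _ I F)
  (res_aug E) (@rees_embed_degree0 _ _ I F) (@res_aug_degree0 _ _ _ _ E)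
  (@rees_embed_inj _ _ I F).
have zP : (<< r *g n >> : laurent_module nneg I) \in
    rees_submod nneg (unit_filtration I).
  apply/rees_submodP => q; split; first exact: mem_full_submod.
  by rewrite mcoeffU; case: eqVneq => // <-; rewrite nn.
pose z : L := Submodule zP.
have zn : z \in gmod_piece L n.
  by apply/rees_module_pieceP => q qn; rewrite mcoeffU eq_sym (negPf qn).
have gz : represents_via (g z) r.
  exists k => c /rF cF; exists (Submodule cF) => //.
  rewrite -linearZ_LR -gE; congr (g _); apply: val_inj.
  exact: rees_module_valZ.
exists (res_diff E 0 (g z)); last by exists (g z).
apply/cocyclesP; split; last exact: res_diff_diff.
  exact/res_diff_degree0/g0.
apply/torsionP; have [l gl] := gz; exists l => c /gl[v cv _].
by rewrite -linearZ_LR cv res_diff_aug.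
Qed.

Lemma represents_multiplies (x : E 1) (r : R) :
  represents x r -> exists k, pp_multiplies_into F k r n.
Proof.
move=> [y _ [k yr]]; exists k => c /yr[v _ vE].
by rewrite -[rees_val c * _]vE; apply: valP.
Qed.

(** If d y = d y' with y' torsion, then y - y' comes from some v in M, and v and
r t^n agree after multiplication by a power of a t^e, a nonzerodivisor.
Conversely, if r t^n is in M, then y minus its image is torsion. *)
Lemma represents_boundary (x : E 1) (r : R) :
  represents x r -> (x \in coboundaries J E 1) = (r \in F n).
Proof.
move=> [y <- [k yr]]; apply/coboundariesP/idP => [[y' /torsionP[k' y't] dyy']|rF].
  have /res_exact0[v vE] : res_diff E 0 (y - y') = 0
    by rewrite linearB dyy' subrr.
  have [c cJ cE] := rees_pp_pow_powerX (maxn k k') aI.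
  have [w cy wE] := yr c (ideal_powS (leq_maxl _ _) cJ).
  have /res_aug_inj wv : res_aug E w = res_aug E (c *: v).
    rewrite linearZ_LR -vE scalerBr cy (y't c) ?subr0 //.
    exact: (ideal_powS (leq_maxr _ _) cJ).
  have vr : submodule_val v = << r *g n >> :> laurent R s.
    have [akreg _] := regular_pairXl (maxn k k') ab_reg.
    apply: (laurent_monomial_lreg (k := mone *+ maxn k k') akreg).
    by rewrite -cE -wE wv; apply/esym/rees_module_valZ.
  have /rees_submodP/(_ n)[] : submodule_val v \in rees_submod nneg F by apply: valP.
  by rewrite vr mcoeffUU.
have vP : (<< r *g n >> : laurent_module nneg I) \in rees_submod nneg F.
  apply/rees_submodP => q; rewrite mcoeffU.
  by case: eqVneq => [<-|_]; [rewrite nn | split=> //; apply: ideal0].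
pose v : M := Submodule vP.
exists (y - res_aug E v); last by rewrite linearB res_diff_aug subr0.
apply/torsionP; exists k => c /yr[w cy wE].
rewrite scalerBr cy -linearZ_LR; apply/eqP; rewrite subr_eq0; apply/eqP.
congr (res_aug E _).
by apply: val_inj; rewrite [LHS]wE; apply/esym/rees_module_valZ.
Qed.

(** On J^k, y acts as a fraction with denominator a^k; comparison with b^k, which
is regular modulo a^k, clears the denominator. *)
Lemma cocycle_represented (x : E 1) :
  x \in cocycles J E 1 n -> exists r, represents x r.
Proof.
move=> /cocyclesP[xn /torsionP[k xt] /res_exactS[y0 xy0]].
have [y yn yx] : exists2 y : E 0, y \in gmod_piece (E 0) n & res_diff E 0 y = x.
  have := @degree0_lift _ _ _ _ _ (res_diff E 0) n y0 (@res_diff_degree0 _ _ _ _ E 0).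
  by rewrite -xy0; apply.
have yM c : c \in ideal_pow J k -> exists v : M, c *: y = res_aug E v.
  by move=> cJ; apply/res_exact0; rewrite linearZ_LR yx; apply: xt.
have [al alJ alE] := rees_pp_pow_powerX k aI.
have [be beJ beE] := rees_pp_pow_powerX k bI.
have [akreg abreg] := regular_pairXr k (regular_pairXl k ab_reg).
have [u un uE] : exists2 u : M, u \in gmod_piece M (mone *+ k + n) &
    al *: y = res_aug E u.
  have [u uE] := yM al alJ.
  have := @degree0_lift _ _ _ _ _ (res_aug E) (mone *+ k + n) u
    (@res_aug_degree0 _ _ _ _ E).
  rewrite -uE; case=> [|u' u'n u'E]; last by exists u'.
  apply: gmod_scale => //; apply/rees_pieceP => q qk.
  by rewrite alE mcoeffU eq_sym (negPf qk).
have [v vE] := yM be beJ.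
have /res_aug_inj buav : res_aug E (be *: u) = res_aug E (al *: v).
  by rewrite !linearZ_LR -uE -vE !scalerA mulrC.
pose u0 := (submodule_val u : laurent R s)@_(mone *+ k + n).
pose v0 := (submodule_val v : laurent R s)@_(mone *+ k + n).
have [r urE] : exists r,
    submodule_val u = << a ^+ k * r *g (mone *+ k + n) >> :> laurent R s.
  (* compare the coefficients of b^k t^(ke) u = a^k t^(ke) v *)
  have eq_coef : u0 * b ^+ k = v0 * a ^+ k.
    have : rees_val be * submodule_val u = rees_val al * submodule_val v :> laurent R s.
      by rewrite -(rees_module_valZ be u) buav; apply: rees_module_valZ.
    move=> /(congr1 (mcoeff (mone *+ k + (mone *+ k + n)))).
    by rewrite alE beE !mcoeff_laurentUM.
  have [r u0E] := abreg _ _ eq_coef.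
  exists r; apply/malgP => q; rewrite mcoeffU.
  case: eqVneq => [<-|qk]; first by rewrite -/u0 u0E mulrC.
  by move/rees_module_pieceP: un => ->; rewrite // eq_sym.
exists r; exists y => //; exists k => c cJ; have [w wE] := yM c cJ.
exists w => //.
have /res_aug_inj awcu : res_aug E (al *: w) = res_aug E (c *: u).
  by rewrite !linearZ_LR -uE -wE !scalerA mulrC.
apply: (laurent_monomial_lreg (k := mone *+ k) akreg).
have : rees_val al * submodule_val w = rees_val c * submodule_val u :> laurent R s.
  by rewrite -(rees_module_valZ al w) awcu; apply: rees_module_valZ.
by rewrite alE urE => ->; rewrite mulrCA laurent_monomialM.
Qed.

Lemma local_cohomology1_ratliff_rush : finite_module (rees_module allZ F) ->
  isomorphic (local_cohomology J E 1 n) (subquotient (ratliff_rush F n) (F n)).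
Proof.
move=> Ffin; apply: (@isomorphic_subquotients R (base_module (E 1)) R^o
  (cocycles J E 1 n) (coboundaries J E 1) (ratliff_rush F n) (F n) represents).
- exact: represents_linear.
- move=> x /cocycle_represented[r xr]; exists r => //.
  by apply/(ratliff_rush_transporter _ Ffin nn)/represents_multiplies/xr.
- move=> r /(ratliff_rush_transporter _ Ffin nn)[k].
  exact: pp_multiplies_represents.
- by move=> x r _ _; apply: represents_boundary.
Qed.
End FirstLocalCohomology.

(** Choose one exponent N with x^N in every I_i; each factor I_i of I^e then
receives one copy of x^N. *)
Lemma primary_power (R : comNzRingType) (m : ideal R) s (I : 'I_s -> ideal R) (x : R) :
  (forall i, primary_to m (I i)) -> x \in m ->
  exists k, x ^+ k \in multipow I mone.
Proof.
move=> Im xm.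
have /choice[k kI] : forall i, exists k, x ^+ k \in I i.
  by move=> i; apply/((Im i).2 x).
pose N := (\max_i k i)%N.
exists (N * \sum_i `|mpos (mone : multideg s) i|)%N; rewrite exprM.
apply: mem_multipowX => i.
by rewrite /N -(subnK (leq_bigmax i)) exprD; apply: idealMl.
Qed.

Theorem proposition4p1 (R : comNzRingType) (m : ideal R) (d s : nat)
    (I : 'I_s -> ideal R) (F : filtration I)
    (E : injective_resolution (rees_gmod nneg F)) :
  cohen_macaulay_local m d -> (2 <= d)%N ->
  infinite_set [set: residue_field m] ->
  (1 <= s)%N -> (forall i, primary_to m (I i)) ->
  admissible F ->
  forall n : multideg s, n \in nneg ->
    isomorphic (local_cohomology (rees_pp I) E 1 n)
               (subquotient (ratliff_rush F n) (F n)).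
Proof.
move=> [_ _ _ mdepth] d2 _ _ Im [_ Ffin] n nn.
have [x [y [xm ym xy]]] := depth_regular_pair mdepth d2.
have [[k xI] [l yI]] := (primary_power Im xm, primary_power Im ym).
apply: (local_cohomology1_ratliff_rush E nn xI yI) Ffin.
exact/regular_pairXr/regular_pairXl.
Qed.
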